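(* Let $d\ge2$ and let $c:V_d\to\ell^\infty(V_d/V_{[0,1/d)})$ be defined by $c(v)=(v-1)\chi_X=\chi_{v\cdot X}-\chi_X$. Then (i) $c(v)\in\ell^2(V_d/V_{[0,1/d)})$ for every $v\in V_d$, and (ii) $c:V_d\to\ell^2(V_d/V_{[0,1/d)})$ is a proper 1-cocycle for the quasi-regular representation of $V_d$ on $\ell^2(V_d/V_{[0,1/d)})$. In particular $V_d$, and therefore also $F_d$ and $T_d$, have the Haagerup property.
   Context: $V_d$ is the Higman–Thompson group of bijections of $[0,1)$ that are piecewise affine on finitely many half-open intervals with endpoints in $\mathbb Z[1/d]$, with slopes powers of $d$; $T_d\le V_d$ consists of those inducing homeomorphisms of the circle $[0,1]/(0\sim1)$ and $F_d\le T_d$ of those inducing homeomorphisms of $[0,1]$. $V_{[0,1/d)}$ is the subgroup of elements acting as the identity on $[0,1/d)$. A standard $d$-adic interval has endpoints $a/d^k,(a+1)/d^k$ with integers $k\ge0$, $0\le a\le d^k-1$; a map $g$ on such an interval $I$ is standard affine if it is affine and $g(I)$ is a standard $d$-adic interval. $X=\{gV_{[0,1/d)}: g\text{ is standard affine on }[0,1/d)\}\subseteq V_d/V_{[0,1/d)}$, and $V_d$ acts on functions on $V_d/V_{[0,1/d)}$ by left translation. A 1-cocycle satisfies $c(v_1v_2)=v_1c(v_2)+c(v_1)$; it is proper if $\{v:\|c(v)\|_2\le r\}$ is finite for every $r$. *)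

(* Defs.v *)
From mathcomp Require Import all_boot all_order all_algebra.
From mathcomp Require Import all_classical all_reals all_analysis.
Import Order.TTheory GRing.Theory Num.Theory.
Local Open Scope classical_set_scope.
Local Open Scope ring_scope.

Set Implicit Arguments.
Unset Strict Implicit.
Unset Printing Implicit Defensive.

Section HigmanThompson.
Variable R : realType.
Variable d : nat.

(* Elements of V_d are encoded as maps R -> R which are the identity outside
   [0,1); the group law is composition. *)

Definition unitI : set R := [set x | 0 <= x < 1].

Definition dadic (x : R) : Prop :=
  exists (a : int) (n : nat), x = a%:~R / (d%:R ^+ n).

Definition Vd (g : R -> R) : Prop :=
  (forall x, ~ unitI x -> g x = x) /\
  (forall y, unitI y -> exists! x, unitI x /\ g x = y) /\
  (forall x, unitI x -> unitI (g x)) /\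
  exists (n : nat) (a : nat -> R) (k : nat -> int) (b : nat -> R),
    a 0%N = 0 /\ a n = 1 /\
    (forall i, (i <= n)%N -> dadic (a i)) /\
    (forall i, (i < n)%N -> a i < a i.+1) /\
    (forall i, (i < n)%N -> forall x, a i <= x < a i.+1 ->
       g x = (d%:R : R) ^ (k i) * x + b i).

Definition Vsub (u : R -> R) : Prop :=
  Vd u /\ forall x, 0 <= x < 1 / d%:R -> u x = x.

(* circle distance on [0,1) viewed as [0,1]/(0~1) *)
Definition cdist (x y : R) : R := Num.min `|x - y| (1 - `|x - y|).

Definition cont_on_unitI (dist : R -> R -> R) (g : R -> R) : Prop :=
  forall x, unitI x -> forall e : R, 0 < e -> exists2 del : R, 0 < del &
    forall y, unitI y -> dist x y < del -> dist (g x) (g y) < e.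

Definition Td (g : R -> R) : Prop :=
  Vd g /\ cont_on_unitI cdist g /\
  exists h, {in unitI, cancel g h} /\ {in unitI, cancel h g} /\
            (forall x, unitI x -> unitI (h x)) /\ cont_on_unitI cdist h.

Definition Fd (g : R -> R) : Prop :=
  Vd g /\ g 0 = 0 /\ cont_on_unitI (fun x y => `|x - y|) g /\
  exists h, {in unitI, cancel g h} /\ {in unitI, cancel h g} /\
            (forall x, unitI x -> unitI (h x)) /\
            cont_on_unitI (fun x y => `|x - y|) h.

Definition coset (g : R -> R) : set (R -> R) :=
  [set h | exists2 u, Vsub u & h = g \o u].

Definition cosets : set (set (R -> R)) :=
  [set S | exists2 g, Vd g & S = coset g].

Definition std_interval (I : set R) : Prop :=
  exists (k a : nat), (a < d ^ k)%N /\
    I = [set y | a%:R / d%:R ^+ k <= y < a.+1%:R / d%:R ^+ k].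

Definition I0 : set R := [set x | 0 <= x < 1 / d%:R].

Definition std_affine (g : R -> R) : Prop :=
  (exists al be : R, forall x, I0 x -> g x = al * x + be) /\
  std_interval (g @` I0).

Definition Xset : set (set (R -> R)) :=
  [set S | exists2 g, Vd g /\ std_affine g & S = coset g].

Definition chiX (S : set (R -> R)) : R := \1_Xset S.

(* quasi-regular representation: (v.f)(S) = f(v^{-1} S), where
   v^{-1} S = [set h | S (v \o h)]. *)
Definition lam (v : R -> R) (f : set (R -> R) -> R) : set (R -> R) -> R :=
  fun S => f [set h | S (v \o h)].

Definition cocyc (v : R -> R) : set (R -> R) -> R :=
  fun S => lam v chiX S - chiX S.

Definition l2sq (f : set (R -> R) -> R) : \bar R :=
  \esum_(S in cosets) ((f S) ^+ 2)%:E.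

End HigmanThompson.

(* Main.v *)
(* A coset g V_{[0,1/d)} is the restriction of g to [0,1/d), so the elements of X
   are indexed by the proper standard intervals J: c(v) counts the J on which v or
   v^-1 is not standard affine.  Every v is standard affine on all sufficiently
   small standard intervals, which makes the support of c(v) finite.  Conversely,
   if v is not standard affine on some interval of level M, it is not so on the
   M - 1 proper intervals above it either, whence ||c(v)||^2 >= M.  So a bound
   on the norm forces both v and v^-1 to be standard affine at some fixed level M;
   then v maps intervals of level M to intervals of level at most 2M, and only
   finitely many v do so. *)
Require Import Defs.
From mathcomp Require Import all_boot all_order all_algebra.
From mathcomp Require Import all_classical all_reals all_analysis.
From mathcomp Require Import lra zify.
Import Order.TTheory GRing.Theory Num.Theory.
Local Open Scope classical_set_scope.
Local Open Scope ring_scope.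

Set Implicit Arguments.
Unset Strict Implicit.
Unset Printing Implicit Defensive.

(** * Standard d-adic intervals and standard affine maps between them *)

Section StandardIntervals.
Variables (R : realType) (d : nat).
Hypothesis d2 : (2 <= d)%N.
Implicit Types (x y : R) (g h v w : R -> R) (k l m n a b c : nat).

Definition itv k a x : Prop := a%:R <= x * d%:R ^+ k < a.+1%:R.

(* "[v] is standard affine on [a/d^k, (a+1)/d^k), with image
   [b/d^l, (b+1)/d^l)", written without division. *)
Definition carries v k a l b : Prop :=
  (b < d ^ l)%N /\
  forall x, itv k a x -> v x * d%:R ^+ l = x * d%:R ^+ k - a%:R + b%:R.

Lemma d_gt0 : (0 < d)%N. Proof. exact: leq_trans d2. Qed.

Lemma dR_gt0 : 0 < (d%:R : R). Proof. by rewrite ltr0n d_gt0. Qed.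

Lemma dX_gt0 k : 0 < (d%:R : R) ^+ k. Proof. by rewrite exprn_gt0 // dR_gt0. Qed.

Lemma dX_neq0 k : (d%:R : R) ^+ k != 0. Proof. by rewrite gt_eqF // dX_gt0. Qed.

Lemma dn_gt0 k : (0 < d ^ k)%N. Proof. by rewrite expn_gt0 d_gt0. Qed.

Lemma itv_left k a : itv k a (a%:R / d%:R ^+ k).
Proof. by rewrite /itv divfK ?dX_neq0 // lexx ltr_nat ltnSn. Qed.

Lemma itv_inj k a b x : itv k a x -> itv k b x -> a = b.
Proof. by move=> /truncn_def <- /truncn_def <-. Qed.

Lemma itv_unitI k a x : (a < d ^ k)%N -> itv k a x -> unitI x.
Proof.
move=> ak /andP[ax xa]; rewrite /unitI /=.
have p := dX_gt0 k.
rewrite -(ler_pM2r p) -(ltr_pM2r p) mul0r mul1r (le_trans _ ax) //=.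
by rewrite (lt_le_trans xa) // -natrX ler_nat.
Qed.

Lemma unitI_itv k x : unitI x ->
  (Num.truncn (x * d%:R ^+ k) < d ^ k)%N /\
  itv k (Num.truncn (x * d%:R ^+ k)) x.
Proof.
move=> /andP[x0 x1]; have p := dX_gt0 k.
have y0 : 0 <= x * d%:R ^+ k by rewrite mulr_ge0 // ltW.
split; last exact: truncn_itv.
by rewrite truncn_lt_nat // natrX -[ltRHS]mul1r ltr_pM2r.
Qed.

Lemma itv_ancestor k n a x : itv (k + n) a x -> itv k (a %/ d ^ n) x.
Proof.
rewrite /itv exprD mulrA => /andP[ax xa]; have p := dX_gt0 n.
apply/andP; split.
  rewrite -(ler_pM2r p) -natrX -natrM natrX (le_trans _ ax) //.
  by rewrite ler_nat leq_trunc_div.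
rewrite -(ltr_pM2r p) (lt_le_trans xa) // -natrX -natrM ler_nat.
by rewrite ltn_ceil // dn_gt0.
Qed.

Lemma ancestor_lt k n a : (a < d ^ (k + n))%N -> (a %/ d ^ n < d ^ k)%N.
Proof. by rewrite ltn_divLR ?dn_gt0 // -expnD. Qed.

Lemma carries_lt v k a l b : carries v k a l b -> (b < d ^ l)%N.
Proof. by case. Qed.

Lemma carries_itv v k a l b x : carries v k a l b -> itv k a x -> itv l b (v x).
Proof.
move=> [_ E] xa; rewrite /itv E //; move: xa; rewrite /itv -!natr1; lra.
Qed.

Lemma carries_comp g v k a l b m c :
  carries g k a l b -> carries v l b m c -> carries (v \o g) k a m c.
Proof.
move=> G V; split=> [|x xa /=]; first exact: carries_lt V.
rewrite (V.2 _ (carries_itv G xa)) (G.2 _ xa); lra.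
Qed.

Lemma carries_inv g h k a l b :
  (a < d ^ k)%N -> cancel g h -> carries g k a l b -> carries h l b k a.
Proof.
move=> ak gK G; split=> // y yb.
set x := (y * d%:R ^+ l - b%:R + a%:R) / d%:R ^+ k.
have xk : x * d%:R ^+ k = y * d%:R ^+ l - b%:R + a%:R.
  by rewrite divfK ?dX_neq0.
have xa : itv k a x by move: yb; rewrite /itv xk -!natr1; lra.
have -> : y = g x.
  by apply: (mulIf (dX_neq0 l)); rewrite G.2 // xk; lra.
by rewrite gK G.2 //; lra.
Qed.

(** The affine map sends the d^n equal parts of the source to those of the target in order, so the
    rank [a %% d ^ n] of a part inside its ancestor is preserved and both levels grow by n. *)
Lemma carries_sub v k l n a b :
  carries v k (a %/ d ^ n) l b ->
  carries v (k + n) a (l + n) (b * d ^ n + a %% d ^ n).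
Proof.
move=> V; split.
  have := ltn_pmod a (dn_gt0 n); have := V.1; rewrite expnD.
  move: (d ^ n)%N (d ^ l)%N (a %% _)%N => N L r; nia.
move=> x /[dup] /itv_ancestor xa _.
rewrite exprD mulrA (V.2 _ xa) natrD natrM natrX.
rewrite {2}(divn_eq a (d ^ n)) natrD natrM natrX !exprD.
by move: (_ %/ _)%:R (_ %% _)%:R (d%:R ^+ k) (d%:R ^+ n) => q r K N; lra.
Qed.

(** The images of the left endpoint [x] and of the midpoint [y] differ by half the length of the
    image, which determines [l]; the image of [x] then determines [b]. *)
Lemma carries_inj v k a l b l' b' :
  carries v k a l b -> carries v k a l' b' -> l = l' /\ b = b'.
Proof.
move=> V V'.
set x := (a%:R : R) / d%:R ^+ k.
set y := ((a%:R : R) + 2^-1) / d%:R ^+ k.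
have xa : itv k a x by exact: itv_left.
have ya : itv k a y by rewrite /itv /y divfK ?dX_neq0 // -(natr1 a); lra.
have := V.2 _ xa; have := V'.2 _ xa; have := V.2 _ ya; have := V'.2 _ ya.
rewrite /x /y !divfK ?dX_neq0 // -/x -/y => e1 e2 e3 e4.
have e5 : (v y - v x) * d%:R ^+ l = 2^-1 by rewrite mulrBl e2 e4; lra.
have e6 : (v y - v x) * d%:R ^+ l' = 2^-1 by rewrite mulrBl e1 e3; lra.
have nz : v y - v x != 0.
  by apply/eqP => e; move: e5; rewrite e mul0r => /esym/eqP; lra.
have ll : l = l'.
  move: e5; rewrite -e6 => /(mulfI nz) /eqP; rewrite -!natrX eqr_nat.
  by rewrite eqn_exp2l // => /eqP.
split=> //; move: e3; rewrite -ll e4 => /eqP.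
by rewrite (inj_eq (addrI _)) eqr_nat => /eqP.
Qed.

End StandardIntervals.

(** * Elements of V_d *)

Section Characterization.
Variables (R : realType) (d : nat).
Hypothesis d2 : (2 <= d)%N.
Implicit Types (x y : R) (g h v w : R -> R) (k l m n a b c : nat).

(** Working form of membership in V_d: an explicit inverse, and one level N at which every standard
    interval is carried. It is equivalent to [Vd] by [tame_Vd] and [Vd_tame]. *)
Definition tame g w : Prop :=
  [/\ cancel g w, cancel w g, forall x, ~ unitI x -> g x = x &
    exists N, forall a, (a < d ^ N)%N -> exists l b, carries d g N a l b].

Let D : R := d%:R.
Let D_neq0 : D != 0. Proof. by rewrite gt_eqF // (dR_gt0 R d2). Qed.

Lemma tame_unitI g w x : tame g w -> unitI x -> unitI (g x).
Proof.
move=> [gK wK gid _] xI; apply: contrapT => gxI.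
have /(can_inj gK) e := gid _ gxI; by apply: gxI; rewrite e.
Qed.

Lemma tame_Vd g w : tame g w -> Vd d g.
Proof.
move=> tg; have [gK wK gid [N gN]] := tg.
split=> //; split.
  move=> y yI; exists (w y); split; last by move=> x [_ <-].
  split=> //; apply: contrapT => wyI.
  by have := gid _ wyI; rewrite wK => e; apply: wyI; rewrite -e.
split; first by move=> x; exact: tame_unitI tg.
(* The value (0, 0) beyond the last interval is only a filler that makes [f] total. *)
have /choice[f fP] : forall i, exists p : nat * nat,
    (i < d ^ N)%N -> carries d g N i p.1 p.2.
  move=> i; have [/gN[l [b gb]]|_] := ltnP i (d ^ N); last by exists (0, 0)%N.
  by exists (l, b).
(* The pieces are the intervals of level N; solving the [carries] equation for the value of g gives
   slope d^(N-l) and shift (b-i)/d^l, where (l, b) is [f i]. *)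
exists (d ^ N)%N, (fun i => i%:R / D ^+ N),
  (fun i => N%:Z - (f i).1%:Z), (fun i => ((f i).2%:R - i%:R) / D ^+ (f i).1).
split; first by rewrite mul0r.
split; first by rewrite natrX divff // (dX_neq0 R d2).
split; first by move=> i _; exists i%:Z, N.
split.
  by move=> i _; rewrite ltr_pM2r ?ltr_nat // invr_gt0 (dX_gt0 R d2).
move=> i iN x.
rewrite ler_pdivrMr ?(dX_gt0 R d2) // ltr_pdivlMr ?(dX_gt0 R d2) // => xi.
rewrite expfzDr // -exprnP -exprnN.
apply: (mulIf (dX_neq0 R d2 (f i).1)); rewrite (fP _ iN).2 // mulrDl.
rewrite divfK ?(dX_neq0 R d2) // mulrAC mulfVK ?(dX_neq0 R d2) //.
by rewrite -/D mulrC; lra.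
Qed.

Lemma dadicP x : dadic d x <-> exists N, x * D ^+ N \is a Num.int.
Proof.
split=> [[z [N ->]]|[N /intrP[z xz]]]; [exists N | exists z, N].
  by rewrite divfK ?(dX_neq0 R d2) // intr_int.
by rewrite -xz mulfK // (dX_neq0 R d2).
Qed.

Lemma dadic_scale_int x : dadic d x ->
  exists N, forall M, (N <= M)%N -> x * D ^+ M \is a Num.int.
Proof.
move=> /dadicP[N xN]; exists N => M NM.
by rewrite -(subnKC NM) exprD mulrA rpredM // rpredX // intr_nat // natr_nat.
Qed.

Lemma dadicB x y : dadic d x -> dadic d y -> dadic d (x - y).
Proof.
move=> /dadic_scale_int[N xN] /dadic_scale_int[M yM].
apply/dadicP; exists (maxn N M).
by rewrite mulrBl rpredB // ?xN ?yM // ?leq_maxl ?leq_maxr.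
Qed.

Lemma dadic0 : dadic d (0 : R).
Proof. by exists 0, 0%N; rewrite mul0r. Qed.

Lemma dadicD x y : dadic d x -> dadic d y -> dadic d (x + y).
Proof.
move=> dx dy; rewrite -[y]opprK -[- y]sub0r.
by apply/dadicB/dadicB => //; exact: dadic0.
Qed.

Lemma dadic_expz x (z : int) : dadic d x -> dadic d (D ^ z * x).
Proof.
move=> /dadicP[N xN]; apply/dadicP; exists (N + absz z)%N.
have -> : D ^ z * x * D ^+ (N + absz z) = x * D ^+ N * (D ^ z * D ^+ absz z).
  by rewrite exprD; lra.
rewrite rpredM // exprnP -expfzDr //.
have -> : z + absz z = (absz (z + absz z))%:Z by lia.
by rewrite -exprnP rpredX // intr_nat // natr_nat.
Qed.

Lemma eventually_all (n : nat) (P : nat -> nat -> Prop) :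
  (forall i, (i < n)%N -> exists N, forall M, (N <= M)%N -> P i M) ->
  exists N, forall M, (N <= M)%N -> forall i, (i < n)%N -> P i M.
Proof.
elim: n => [|n IH] nP; first by exists 0%N.
have [|N PN] := IH; first by move=> i /ltnW /nP.
have [N' PN'] := nP _ (ltnSn n).
exists (maxn N N') => M; rewrite geq_max => /andP[NM N'M] i.
by rewrite ltnS leq_eqVlt => /predU1P[->|]; [exact: PN'|exact: PN].
Qed.

End Characterization.

(** * From breakpoints and slopes to a uniform level of standard affinity *)

Section Breakpoints.
Variables (R : realType) (d : nat).
Hypothesis d2 : (2 <= d)%N.
Implicit Types (x y : R) (i j m : nat).
Let D : R := d%:R.
Variables (g : R -> R) (n : nat) (a : nat -> R) (k : nat -> int) (b : nat -> R).
Hypothesis g_surj : forall y, unitI y -> exists2 x, unitI x & g x = y.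
Hypothesis g_inj : forall x y, unitI x -> unitI y -> g x = g y -> x = y.
Hypothesis g_unitI : forall x, unitI x -> unitI (g x).
Hypothesis a0 : a 0%N = 0.
Hypothesis an : a n = 1.
Hypothesis da : forall i, (i <= n)%N -> dadic d (a i).
Hypothesis a_lt : forall i, (i < n)%N -> a i < a i.+1.
Hypothesis gE : forall i, (i < n)%N -> forall x, a i <= x < a i.+1 ->
  g x = D ^ (k i) * x + b i.

Lemma break_lt i j : (i < j)%N -> (j <= n)%N -> a i < a j.
Proof.
elim: j => // j IH; rewrite ltnS leq_eqVlt => /predU1P[->|ij] jn; first exact: a_lt.
exact: lt_trans (IH ij (ltnW jn)) (a_lt jn).
Qed.

Lemma break_le i j : (i <= j)%N -> (j <= n)%N -> a i <= a j.
Proof. by rewrite leq_eqVlt => /predU1P[->//|ij] jn; rewrite ltW // break_lt. Qed.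

Lemma break_locate x : unitI x -> exists2 i, (i < n)%N & a i <= x < a i.+1.
Proof.
move=> /andP[x0 x1].
suff locate m : (m <= n)%N -> x < a m -> exists2 i, (i < n)%N & a i <= x < a i.+1.
  by apply: (locate n) => //; rewrite an.
elim: m => [|m IH] mn; first by rewrite a0 ltNge x0.
move=> xm; case: (ltP x (a m)) => [|mx]; first exact: IH (ltnW mn).
by exists m => //; rewrite mx.
Qed.

Lemma break_uniq i j x : (i < n)%N -> (j < n)%N ->
  a i <= x < a i.+1 -> a j <= x < a j.+1 -> i = j.
Proof.
move=> iN jN /andP[ix xi] /andP[jx xj].
have [ij|ji|//] := ltngtP i j.
  by have := le_lt_trans jx xi; rewrite ltNge break_le // ltnW.
by have := le_lt_trans ix xj; rewrite ltNge break_le // ltnW.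
Qed.

Lemma break_unitI i : (i < n)%N -> unitI (a i).
Proof. by move=> iN; rewrite /unitI /= -a0 -an break_le ?break_lt // ltnW. Qed.

Lemma break_itv i : (i < n)%N -> a i <= a i < a i.+1.
Proof. by move=> iN; rewrite lexx a_lt. Qed.

(* Let [p i] be the left endpoint of the image of the i-th piece.  The piece
   whose image ends where the i-th image starts has a smaller [p], and lengths of
   images are d-adic, so a minimal non-d-adic [p i] cannot exist. *)
Lemma break_image_dadic i : (i < n)%N -> dadic d (g (a i)).
Proof.
move=> iN; apply: contrapT => ndi.
pose P := [pred j : 'I_n | ~~ `[< dadic d (g (a j)) >]].
have Pi : P (Ordinal iN) by apply/asboolPn.
case: (arg_minP (fun j : 'I_n => g (a j)) Pi) => {ndi Pi}i0 /asboolPn ndi imin.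
have pos j : (0 : R) < D ^ (k j) by rewrite exprz_gt0 // (dR_gt0 R d2).
have i0n := ltn_ord i0.
have gi_gt0 : 0 < g (a i0).
  have /andP[gi0 _] := g_unitI (break_unitI i0n).
  rewrite lt_neqAle gi0 andbT; apply/eqP => e; apply: ndi.
  by rewrite -e; exact: dadic0.
have low j : (j < n)%N -> forall x, a j <= x < a j.+1 -> g (a j) <= g x.
  move=> jn x /andP[jx xj]; rewrite !(gE jn) ?break_itv ?jx //.
  by rewrite lerD2r ler_pM2l.
(* The piece containing the preimage of 0 starts at value at most 0, so some image starts below that
   of [i0]; among those, [j] will have the highest start. *)
have [j0 gj0] : exists j : 'I_n, g (a j) < g (a i0).
  have [|x xI gx0] := g_surj (y := 0); first by rewrite /unitI /= lexx ltr01.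
  have [j jn xj] := break_locate xI.
  exists (Ordinal jn) => /=; apply: le_lt_trans gi_gt0.
  by rewrite -gx0 low.
case: (@arg_maxP _ _ _ j0 (fun j : 'I_n => g (a j) < g (a i0))
  (fun j : 'I_n => g (a j)) gj0).
move=> {gj0}j gj jmax; have jn := ltn_ord j.
pose q := g (a j) + D ^ (k j) * (a j.+1 - a j).
have gj_lt x : a j <= x < a j.+1 -> g x < q.
  move=> xj; rewrite /q !(gE jn) ?break_itv //.
  case/andP: xj => _ xj; rewrite -(ltr_pM2l (pos j)) in xj; lra.
have jq y : g (a j) <= y < q -> exists2 x, a j <= x < a j.+1 & g x = y.
  move=> /andP[jy yq]; exists (a j + (y - g (a j)) / D ^ (k j)).
    rewrite lerDl divr_ge0 ?subr_ge0 ?(ltW (pos j)) //=.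
    by rewrite -ltrBrDl ltr_pdivrMr // mulrC ltrBlDl.
  rewrite (gE jn).
    rewrite mulrDr (mulrC _ (_ / _)) divfK ?gt_eqF //.
    rewrite (gE jn) ?break_itv //; lra.
  rewrite lerDl divr_ge0 ?subr_ge0 ?(ltW (pos j)) //=.
  by rewrite -ltrBrDl ltr_pdivrMr // mulrC ltrBlDl.
have piece_unitI m x : (m < n)%N -> a m <= x < a m.+1 -> unitI x.
  move=> mn /andP[mx xm]; rewrite /unitI /=.
  rewrite -a0 -an (le_trans _ mx) ?break_le ?(ltnW mn) //=.
  by rewrite (lt_le_trans xm) // break_le.
(* The image of piece [j] ends at [q]. If [q] exceeded [g (a i0)], the images of [j] and [i0] would
   overlap. If it were smaller, the piece [m] attaining [q] would start no higher than [j] by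
   maximality, hence also attain [g (a j)]; then m = j, whose image omits [q]. *)
have : q = g (a i0).
  apply/eqP; rewrite eq_le; apply/andP; split.
    rewrite leNgt; apply/negP => iq.
    have [|x xj gx] := jq (g (a i0)); first by rewrite ltW.
    have xi := g_inj (piece_unitI _ _ jn xj) (break_unitI i0n) gx.
    have := break_uniq jn i0n xj; rewrite xi => /(_ (break_itv i0n)) e.
    by rewrite e ltxx in gj.
  rewrite leNgt; apply/negP => qi.
  have qI : unitI q.
    have /andP[gj0 _] := g_unitI (break_unitI jn).
    have /andP[_ gi1] := g_unitI (break_unitI i0n).
    rewrite /unitI /= (lt_trans qi) // (le_trans gj0) //= lerDl.
    by rewrite mulr_ge0 ?subr_ge0 ?(ltW (pos j)) // ltW // a_lt.
  have [x xI gx] := g_surj qI; have [m mn xm] := break_locate xI.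
  have gmq : g (a m) <= q by rewrite -gx low.
  have gmj : g (a m) <= g (a j).
    exact: (jmax (Ordinal mn) (le_lt_trans gmq qi)).
  pose y := a m + (g (a j) - g (a m)) / D ^ (k m).
  have ym : a m <= y < a m.+1.
    rewrite /y lerDl divr_ge0 ?subr_ge0 ?(ltW (pos m)) //=.
    have : g (a j) < g x by rewrite gx /q ltrDl mulr_gt0 // subr_gt0 a_lt.
    case/andP: xm => mx xm.
    rewrite -ltrBrDl ltr_pdivrMr // (gE mn (x := x)) ?mx //.
    rewrite (gE mn (x := a m)) ?break_itv //.
    rewrite -(ltr_pM2l (pos m)) in xm; lra.
  have gy : g y = g (a j).
    rewrite (gE mn ym) /y mulrDr (mulrC _ (_ / _)) divfK ?gt_eqF //.
    rewrite (gE mn (x := a m)) ?break_itv //; lra.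
  have yj := g_inj (piece_unitI _ _ mn ym) (break_unitI jn) gy.
  rewrite yj in ym; have mj := break_uniq mn jn ym (break_itv jn).
  have := gj_lt x; rewrite -mj => /(_ xm).
  by rewrite gx ltxx.
move=> qi; apply: ndi; rewrite -qi.
apply: dadicD => //; last first.
  by apply: dadic_expz => //; apply: dadicB => //; apply: da; rewrite // ltnW.
(* Minimality of [i0] makes the lower start [g (a j)] d-adic. *)
apply: contrapT => ndj; have /= := imin j; rewrite leNgt gj.
by move/(_ _)/notF; apply; apply/asboolPn.
Qed.

Lemma break_shift_dadic i : (i < n)%N -> dadic d (b i).
Proof.
move=> iN; have -> : b i = g (a i) - D ^ k i * a i.
  by rewrite (gE iN) ?break_itv //; lra.
apply: dadicB => //; first exact: break_image_dadic.
by apply: dadic_expz => //; apply: da; exact: ltnW.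
Qed.

Lemma break_carries :
  exists N, forall c, (c < d ^ N)%N -> exists l b, carries d g N c l b.
Proof.
(* At a large level M, all right breakpoints scale to integers, and each slope is d^(M-l) with l
   large enough for d^l to clear the denominator of [b i]. *)
have [N NP] : exists N, forall M, (N <= M)%N -> forall i, (i < n)%N ->
    a i.+1 * D ^+ M \is a Num.int /\
    exists2 l : nat, k i = M%:Z - l%:Z & b i * D ^+ l \is a Num.int.
  apply: eventually_all => i iN.
  have [N1 aN] := dadic_scale_int d2 (da iN).
  have [N2 bN] := dadic_scale_int d2 (break_shift_dadic iN).
  (* Adding |k i| keeps M - k i at least [N2], so it is a natural number and a valid exponent for
     [bN]. *)
  exists (maxn N1 (N2 + absz (k i))) => M; rewrite geq_max => /andP[N1M N2M].
  split; first exact: aN.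
  exists (absz (M%:Z - k i)); first lia.
  apply: bN; lia.
exists N => c cN; have {}NP := NP _ (leqnn N).
set x0 : R := c%:R / D ^+ N.
have x0c : itv d N c x0 := itv_left R d2 N c.
have [i iN xi] := break_locate (itv_unitI d2 cN x0c).
have [/intrP[z az] [l kl /intrP[z' bz]]] := NP _ iN.
have pN := dX_gt0 R d2 N; have pl := dX_gt0 R d2 l.
have x0N : x0 * D ^+ N = c%:R by rewrite divfK // gt_eqF.
have gl x : itv d N c x -> g x * D ^+ l = x * D ^+ N + z'%:~R.
  rewrite {1}/itv => /andP[cx xc]; rewrite (gE iN).
    rewrite mulrDl bz; congr (_ + _); rewrite mulrAC mulrC; congr (_ * _).
    by rewrite exprnP -expfzDr ?kl ?subrK // gt_eqF ?(dR_gt0 R d2).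
  (* The scaled right breakpoint is an integer above c, hence at least c+1: the interval does not
     cross it. *)
  case/andP: xi => ix xi; apply/andP; split.
    by apply: le_trans ix _; rewrite -(ler_pM2r pN) x0N.
  rewrite -(ltr_pM2r pN) az (lt_le_trans xc) //.
  move: xi; rewrite -(ltr_pM2r pN) az x0N.
  by rewrite -[c%:R]/(c%:Z%:~R) -[c.+1%:R]/(c.+1%:Z%:~R) ltr_int ler_int; lia.
(* The image of the left endpoint lies in [0,1), which makes the integer c + z' a valid position at
   level l. *)
have /andP[g0 g1] := g_unitI (itv_unitI d2 cN x0c).
have Bc : (c%:Z + z')%:~R = c%:R + z'%:~R :> R by rewrite rmorphD.
have B0 : 0 <= c%:Z + z'.
  rewrite -(ler_int R) Bc -x0N -gl //.
  by rewrite mulr_ge0 // ltW.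
exists l, (absz (c%:Z + z')).
have Bl : (absz (c%:Z + z'))%:R = c%:R + z'%:~R :> R.
  by rewrite natr_absz ger0_norm.
split; last by move=> x xc; rewrite gl // Bl; lra.
rewrite -(ltr_nat R) Bl -x0N -gl // natrX -[ltRHS]mul1r ltr_pM2r //.
Qed.

End Breakpoints.

Lemma Vd_tame (R : realType) (d : nat) (g : R -> R) :
  (2 <= d)%N -> Vd d g -> exists w, tame d g w.
Proof.
move=> d2 [gid [gbij [gI [n [a [k [b [a0 [an [da [a_lt gE]]]]]]]]]]].
have gsurj y : exists x, g x = y.
  have [/gbij[x [[_ gx] _]]|yI] := pselect (unitI y); first by exists x.
  by exists y; exact: gid.
have ginj x y : unitI x -> unitI y -> g x = g y -> x = y.
  move=> xI yI e; have [z [_ zU]] := gbij _ (gI _ yI).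
  by rewrite -(zU x) // -(zU y).
(* [w] is chosen as a right inverse; the four cases, according to which points lie in [0,1), show
   that it is also a left inverse. *)
have /choice[w wK] := gsurj; exists w; split=> //.
  move=> x; have := wK (g x).
  have [xI|xI] := pselect (unitI x); have [wI|wI] := pselect (unitI (w (g x))).
  - exact: ginj.
  - by rewrite gid // => e; case: wI; rewrite e; exact: gI.
  - by rewrite [in RHS]gid // => e; case: xI; rewrite -e; exact: gI.
  - by rewrite gid // => ->; exact: gid.
apply: (break_carries d2 _ ginj gI a0 an da a_lt gE).
by move=> y /gbij[x [[xI gx] _]]; exists x.
Qed.

(** * Group operations, and transitivity on proper standard intervals *)

Section Group.
Variables (R : realType) (d : nat).
Hypothesis d2 : (2 <= d)%N.
Implicit Types (x y : R) (g h v w u : R -> R) (k l m n a b c : nat).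

Lemma tame_carries v w : tame d v w ->
  exists N, forall M, (N <= M)%N -> forall a, (a < d ^ M)%N ->
    exists l b, carries d v M a l b.
Proof.
move=> [_ _ _ [N vN]]; exists N => M NM a aM.
have [|l [b vab]] := vN (a %/ d ^ (M - N))%N.
  by apply: (ancestor_lt d2); rewrite subnKC.
by have := carries_sub d2 vab; rewrite subnKC //; eexists; eexists; eassumption.
Qed.

(** Let L bound the levels of the images under [v] of the intervals of level N. Every interval of
    level L lies in one of these images, on which [w] is standard affine. *)
Lemma tame_inv v w : tame d v w -> tame d w v.
Proof.
move=> tv; have [vK wK vid [N vN]] := tv; split=> //.
  by move=> x /vid {1}<-; rewrite vK.
have [L LP] : exists L, forall M, (L <= M)%N -> forall a, (a < d ^ N)%N ->
    exists l b, carries d v N a l b /\ (l <= M)%N.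
  apply: eventually_all => a /vN[l [b vab]].
  by exists l => M lM; exists l, b.
exists L => c cL; have {}LP := LP _ (leqnn L).
set y : R := c%:R / d%:R ^+ L.
have yc : itv d L c y := itv_left R d2 L c.
have wyI : unitI (w y).
  apply: contrapT => wyI; have e := vid _ wyI; apply: wyI.
  by rewrite -e wK; exact: itv_unitI yc.
have [aN wya] := unitI_itv d2 N wyI.
set a := Num.truncn _ in aN wya.
have [l [b [vab lL]]] := LP _ aN.
have := carries_itv vab wya; rewrite wK => yb.
have yc' : itv d l (c %/ d ^ (L - l)) y by apply: itv_ancestor; rewrite ?subnKC.
have wba := carries_inv d2 aN vK vab.
rewrite (itv_inj yb yc') in wba.
by have := carries_sub d2 wba; rewrite subnKC //; eexists; eexists; eassumption.
Qed.

Lemma tame_comp g w v u : tame d g w -> tame d v u -> tame d (v \o g) (w \o u).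
Proof.
move=> tg tv; have [gK wK gid [N gN]] := tg; have [vK uK vid _] := tv.
have [N' vN] := tame_carries tv.
split; [exact: can_comp|exact: can_comp|by move=> x xI /=; rewrite gid // vid|].
(* Refining by N' levels pushes the images under [g] to level at least N', where [v] carries every
   interval. *)
exists (N + N')%N => a aN.
have [l [b gab]] := gN _ (ancestor_lt d2 aN).
have {}gab := carries_sub d2 gab.
have [|m [c vbc]] := vN _ _ _ (carries_lt gab); first exact: leq_addl.
by exists m, c; exact: carries_comp gab vbc.
Qed.

Lemma Vd_comp g v : Vd d g -> Vd d v -> Vd d (v \o g).
Proof.
move=> /(Vd_tame d2)[w tg] /(Vd_tame d2)[u tv].
exact: (tame_Vd d2 (tame_comp tg tv)).
Qed.

(** When the two intervals are disjoint, this is the involution of V_d exchanging them affinely. *)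
Definition swap k a l b x : R :=
  if `[< itv d k a x >] then (x * d%:R ^+ k - a%:R + b%:R) / d%:R ^+ l
  else if `[< itv d l b x >] then (x * d%:R ^+ l - b%:R + a%:R) / d%:R ^+ k
  else x.

Section Swap.
Variables (k a l b : nat).
Hypotheses (ak : (a < d ^ k)%N) (bl : (b < d ^ l)%N).
Hypothesis disj : forall x, itv d k a x -> itv d l b x -> False.

Lemma swap_carriesl : carries d (swap k a l b) k a l b.
Proof. by split=> // x /asboolT xa; rewrite /swap xa divfK // (dX_neq0 R d2). Qed.

Lemma swap_carriesr : carries d (swap k a l b) l b k a.
Proof.
split=> // x xb; rewrite /swap asboolF; last by move=> xa; exact: disj xb.
by rewrite asboolT // divfK // (dX_neq0 R d2).
Qed.

Lemma swapK : involutive (swap k a l b).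
Proof.
move=> x; have [xa|xa] := pselect (itv d k a x).
  have E := swap_carriesl.2 _ xa.
  have E' := swap_carriesr.2 _ (carries_itv swap_carriesl xa).
  by apply: (mulIf (dX_neq0 R d2 k)); rewrite E' E; lra.
have [xb|xb] := pselect (itv d l b x).
  have E := swap_carriesr.2 _ xb.
  have E' := swap_carriesl.2 _ (carries_itv swap_carriesr xb).
  by apply: (mulIf (dX_neq0 R d2 l)); rewrite E' E; lra.
by have e : swap k a l b x = x; rewrite ?e // /swap !asboolF.
Qed.

Lemma swap_tame : tame d (swap k a l b) (swap k a l b).
Proof.
split; [exact: swapK|exact: swapK| |].
  move=> x xI; rewrite /swap !asboolF // => /(itv_unitI d2); auto.
(* At level k + l, an interval lies inside one of the swapped intervals or misses both; its
   ancestors at levels k and l decide which. *)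
exists (k + l)%N => c cN.
have [ca|ca] := eqVneq (c %/ d ^ l)%N a.
  have := swap_carriesl; rewrite -{2}ca => /(carries_sub d2) sc.
  by eexists; eexists; exact: sc.
have [cb|cb] := eqVneq (c %/ d ^ k)%N b.
  have := swap_carriesr; rewrite -{2}cb => /(carries_sub d2) sc.
  by rewrite addnC; eexists; eexists; exact: sc.
exists (k + l)%N, c; split=> // x xc.
rewrite /swap !asboolF; first lra.
  rewrite addnC in xc; move=> /itv_inj/(_ (itv_ancestor d2 xc)) e.
  by rewrite e eqxx in cb.
move=> /itv_inj/(_ (itv_ancestor d2 xc)) e.
by rewrite e eqxx in ca.
Qed.

End Swap.

(** A target outside [0,1/d) is reached by a single swap. A target inside it overlaps the source, so
    the route goes through [1/d,2/d), which exists as d is at least 2. *)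
Lemma Vd_carries_exists k a : (0 < k)%N -> (a < d ^ k)%N ->
  exists2 g : R -> R, Vd d g & carries d g 1 0 k a.
Proof.
case: k => // k _ ak.
have itv1 b x : itv d k.+1 b x -> itv d 1 (b %/ d ^ k) x.
  exact: (@itv_ancestor _ _ d2 1 k).
have [a0|a0] := eqVneq (a %/ d ^ k)%N 0%N; last first.
  have disj x : itv d 1 0 x -> itv d k.+1 a x -> False.
    by move=> x0 /itv1 /(itv_inj x0) e; rewrite -e in a0.
  exists (swap 1 0 k.+1 a); last exact: swap_carriesl.
  by apply: (tame_Vd d2); apply: swap_tame => //; rewrite expn1 (ltnW d2).
have disj1 x : itv d 1 0 x -> itv d 1 1 x -> False.
  by move=> x0 /(itv_inj x0).
have disj2 x : itv d 1 1 x -> itv d k.+1 a x -> False.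
  by move=> x0 /itv1 /(itv_inj x0) e; rewrite a0 in e.
exists (swap 1 1 k.+1 a \o swap 1 0 1 1).
  by apply: Vd_comp; apply: (tame_Vd d2); apply: swap_tame => //;
    rewrite expn1 ?(ltnW d2).
apply: carries_comp (swap_carriesl _ _ _) (swap_carriesl _ _ _) => //.
Qed.

End Group.

(** * Cosets *)

Section Cosets.
Variables (R : realType) (d : nat).
Hypothesis d2 : (2 <= d)%N.
Implicit Types (x y : R) (g h v w u : R -> R) (k l m n a b c : nat).

Lemma I0_itv x : I0 d x <-> itv d 1 0 x.
Proof.
rewrite /itv /I0 /= expr1 ltr_pdivlMr ?(dR_gt0 R d2) //.
by rewrite pmulr_lge0 // (dR_gt0 R d2).
Qed.

(** The half-open image [P,Q) forces a positive slope, value P at 0 and limit Q at 1/d, which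
    determines the affine map. *)
Lemma std_affineP g : std_affine d g <-> exists k a, carries d g 1 0 k a.
Proof.
have p0 := dR_gt0 R d2.
split=> [[[al [be gE]] [k [a [ak E]]]]|[k [a gka]]].
  have pk := dX_gt0 R d2 k.
  have inE y : (exists2 x, I0 d x & al * x + be = y) <->
      a%:R / d%:R ^+ k <= y < a.+1%:R / d%:R ^+ k.
    have := E; rewrite predeqE => /(_ y) /= <-; split=> -[x xI <-]; exists x => //.
      by rewrite gE.
    by rewrite gE.
  set P := a%:R / d%:R ^+ k in inE; set Q := a.+1%:R / d%:R ^+ k in inE.
  have PQ : P < Q by rewrite /P /Q ltr_pM2r ?invr_gt0 // ltr_nat.
  have dI : 0 < 1 / d%:R :> R by rewrite divr_gt0.
  have I00 : I0 d (0 : R) by rewrite /I0 /= lexx.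
  have /andP[Pbe beQ] : P <= be < Q by apply/inE; exists 0; rewrite // mulr0 add0r.
  have al0 : 0 < al.
    rewrite ltNge; apply/negP => al0.
    (* A value strictly above the value [be] at 0 is attained, which a slope at most 0 does not
       allow. *)
    have [x /andP[x0 _] ex] : exists2 x, I0 d x & al * x + be = (be + Q) / 2.
      by apply/inE; lra.
    have : al * x <= 0 by rewrite mulr_le0_ge0.
    lra.
  have beP : be = P.
    have [x /andP[x0 _] ex] : exists2 x, I0 d x & al * x + be = P.
      by apply/inE; rewrite lexx.
    have : 0 <= al * x by rewrite mulr_ge0 // ltW.
    lra.
  (* A larger value at 1/d would put the excluded end [Q] in the image; a smaller one would be
     attained again at a point below 1/d. *)
  have alQ : al * (1 / d%:R) + be = Q.
    apply/eqP; rewrite eq_le; apply/andP; split; rewrite leNgt; apply/negP => lt.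
      have : P <= Q < Q.
        apply/inE; exists ((Q - be) / al).
          apply/andP; split; first by rewrite divr_ge0 ?(ltW al0) //; lra.
          by rewrite ltr_pdivrMr //; lra.
        by rewrite mulrC divfK ?gt_eqF //; lra.
      by rewrite ltxx andbF.
    have : 0 < al * (1 / d%:R) by rewrite mulr_gt0.
    move=> al1; have : P <= al * (1 / d%:R) + be < Q by lra.
    move=> /inE[x /andP[_ x1] /addIr e].
    move: x1; rewrite -(ltr_pM2l al0); lra.
  exists k, a; split=> // x /I0_itv xI.
  rewrite gE //; have Pk : P * d%:R ^+ k = a%:R by rewrite divfK ?gt_eqF.
  have Qk : Q * d%:R ^+ k = a%:R + 1 by rewrite divfK ?gt_eqF // natr1.
  have alk : al * d%:R ^+ k = d%:R.
    have -> : al = (Q - P) * d%:R.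
      by rewrite -alQ beP addrK mulrA mulr1 divfK // gt_eqF.
    by rewrite mulrAC mulrBl Qk Pk; lra.
  by rewrite mulrDl mulrAC alk beP Pk expr1; lra.
have pk := dX_gt0 R d2 k.
split.
  exists (d%:R / d%:R ^+ k), (a%:R / d%:R ^+ k) => x /I0_itv xI.
  apply: (mulIf (dX_neq0 R d2 k)); rewrite gka.2 // mulrDl divfK ?gt_eqF //.
  by rewrite mulrAC divfK ?gt_eqF // expr1; lra.
exists k, a; split; first exact: carries_lt gka.
apply/seteqP; split=> [_ [x /I0_itv xI <-]|y /=] /=.
  have := carries_itv gka xI; rewrite /itv.
  by rewrite ler_pdivrMr // ltr_pdivlMr.
rewrite ler_pdivrMr // ltr_pdivlMr // => yI.
have xI : itv d 1 0 ((y * d%:R ^+ k - a%:R) / d%:R).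
  by rewrite /itv expr1 divfK ?gt_eqF // -natr1; move: yI; rewrite -(natr1 a); lra.
exists ((y * d%:R ^+ k - a%:R) / d%:R); first exact/I0_itv.
apply: (mulIf (dX_neq0 R d2 k)); rewrite gka.2 // expr1 divfK ?gt_eqF //; lra.
Qed.

Lemma cosetE g : Vd d g ->
  coset d g = [set h | Vd d h /\ forall x, I0 d x -> h x = g x].
Proof.
move=> vg; have [w tg] := Vd_tame d2 vg; have [gK wK _ _] := tg.
apply/seteqP; split=> h /=.
  by move=> [u [vu uid] ->]; split=> [|x xI /=]; [exact: Vd_comp|rewrite uid].
move=> [vh hg]; exists (w \o h); last by apply/funext => x /=; rewrite wK.
split; last by move=> x xI /=; rewrite hg.
by apply: Vd_comp => //; exact: tame_Vd (tame_inv d2 tg).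
Qed.

Lemma coset_refl g : Vd d g -> coset d g g.
Proof. by move=> vg; rewrite cosetE. Qed.

Definition std_coset k a : set (R -> R) :=
  [set h | Vd d h /\ carries d h 1 0 k a].

Lemma coset_std g k a : Vd d g -> carries d g 1 0 k a ->
  coset d g = std_coset k a.
Proof.
move=> vg ga; rewrite cosetE //; apply/seteqP; split=> h /= [vh hg]; split=> //.
  split=> [|x xI]; first exact: carries_lt ga.
  by rewrite hg ?ga.2 //; exact/I0_itv.
move=> x /I0_itv xI.
by apply: (mulIf (dX_neq0 R d2 k)); rewrite ga.2 // hg.2.
Qed.

Lemma Xset_coset g : Vd d g ->
  Xset d (coset d g) <-> exists k a, carries d g 1 0 k a.
Proof.
move=> vg; split=> [[h [vh /std_affineP[k [a ha]]] e]|/std_affineP ga]; last first.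
  by exists g.
exists k, a; have := coset_refl vg.
by rewrite e (coset_std vh ha) => -[].
Qed.

Lemma translate_coset v w g : cancel v w -> cancel w v ->
  [set h | coset d g (v \o h)] = coset d (w \o g).
Proof.
move=> vK wK; apply/seteqP; split=> h [u uV e]; exists u => //; apply/funext => x /=.
  by have /(congr1 w) := congr1 (@^~ x) e; rewrite /= vK.
by rewrite e /= wK.
Qed.

(** The value is 0, 1 or -1, and is nonzero when precisely one of the cosets of [g] and [w \o g]
    lies in X. *)
Lemma cocycE v w g : cancel v w -> cancel w v ->
  cocyc d v (coset d g) =
    (coset d (w \o g) \in Xset d)%:R - (coset d g \in Xset d)%:R.
Proof.
by move=> vK wK; rewrite /cocyc /lam /chiX !indicE (translate_coset _ vK wK).
Qed.

End Cosets.

(** * Norm estimates, finite support and properness of the cocycle *)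

Section Cocycle.
Variables (R : realType) (d : nat).
Hypothesis d2 : (2 <= d)%N.
Implicit Types (x y : R) (g h v w u : R -> R) (k l m n a b c M : nat).
Implicit Types (f : set (R -> R) -> R) (S : set (R -> R)).

Lemma l2sq_finite f : finite_set [set S | cosets d S /\ f S != 0] ->
  (l2sq d f < +oo)%E.
Proof.
set A := [set S | _] => finA.
have -> : l2sq d f = (\esum_(S in A) ((f S) ^+ 2)%:E)%E.
  rewrite /l2sq esum_mkcond [RHS]esum_mkcond; apply: eq_esum => S _.
  have [SA|SA] := pselect (A S).
    by rewrite !mem_set //; case: SA.
  rewrite (memNset SA); case: ifP => // /set_mem cS.
  have [->|fS] := eqVneq (f S) 0; first by rewrite expr0n.
  by case: SA.
rewrite esum_fset // => [|S _]; last by rewrite lee_fin sqr_ge0.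
by rewrite fsumEFin // ltry.
Qed.

Lemma l2sq_ge f M (F : nat -> set (R -> R)) :
  (forall i, (i < M)%N -> cosets d (F i) /\ f (F i) ^+ 2 = 1) ->
  (forall i j, (i < M)%N -> (j < M)%N -> F i = F j -> i = j) ->
  (M%:R%:E <= l2sq d f)%E.
Proof.
move=> FM Finj; apply: esum_ge; exists (F @` `I_M).
  split; first by apply: finite_image; exact: finite_II.
  by move=> _ [i /FM[cF _] <-].
rewrite fsbig_image; last by move=> i j /set_mem iM /set_mem jM; exact: Finj.
rewrite (eq_fsbigr (fun=> 1%:E)); last by move=> i /set_mem /FM[_ ->].
rewrite fsumEFin; last exact: finite_II.
by rewrite lee_fin -fsbig_ord sumr_const card_ord.
Qed.

(** The index i stands for level i+1: level 0 is left out because no bijection in V_d maps [0,1/d)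
    onto [0,1). *)
Definition ancestor M c i : nat := (c %/ d ^ (M - i.+1))%N.

Lemma not_carries_ancestor v M c : ~ (exists l b, carries d v M c l b) ->
  forall i, (i < M)%N -> ~ (exists l b, carries d v i.+1 (ancestor M c i) l b).
Proof.
move=> vM i iM [l [b vi]]; apply: vM.
have := carries_sub d2 vi; rewrite subnKC //; by eexists; eexists; eassumption.
Qed.

Lemma ancestor_chain M c : (c < d ^ M)%N ->
  exists g : nat -> R -> R, forall i, (i < M)%N ->
    Vd d (g i) /\ carries d (g i) 1 0 i.+1 (ancestor M c i).
Proof.
move=> cM.
have /choice[g gP] : forall i, exists g : R -> R, (i < M)%N ->
    Vd d g /\ carries d g 1 0 i.+1 (ancestor M c i).
  move=> i; have [iM|_] := ltnP i M; last by exists id.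
  have [|g vg ga] := Vd_carries_exists R d2 (ltn0Sn i) (a := ancestor M c i).
    by apply: (ancestor_lt d2); rewrite subnKC.
  by exists g.
by exists g.
Qed.

(* If the interval [c/d^M, (c+1)/d^M) is not carried, neither are its ancestors of
   levels 1, ..., M; the cosets that these index, and their translates, each
   contribute 1 to the squared norm. *)
Lemma not_carries_l2sq v w M c : tame d v w -> (c < d ^ M)%N ->
  ~ (exists l b, carries d v M c l b) ->
  (M%:R%:E <= l2sq d (cocyc d v))%E /\ (M%:R%:E <= l2sq d (cocyc d w))%E.
Proof.
move=> tv cM vM; have [vK wK _ _] := tv.
have vV := tame_Vd d2 tv; have wV := tame_Vd d2 (tame_inv d2 tv).
have [g gP] := ancestor_chain cM.
have vgX i : (i < M)%N -> ~ Xset d (coset d (v \o g i)).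
  move=> iM; have [gV gc] := gP _ iM.
  move=> /(Xset_coset d2 (Vd_comp d2 gV vV))[k [a vgc]].
  apply: (not_carries_ancestor vM iM); exists k, a.
  have [u tg] := Vd_tame d2 gV; have [gK uK _ _] := tg.
  (* If [v \o g i] were standard affine on [0,1/d), precomposing with the inverse of [g i] would
     make [v] carry the ancestor. *)
  have -> : v = (v \o g i) \o u by apply/funext => x /=; rewrite uK.
  by apply: carries_comp vgc; apply: carries_inv gc => //; rewrite expn1 d_gt0.
have gX i : (i < M)%N -> Xset d (coset d (g i)).
  move=> iM; have [gV gc] := gP _ iM.
  by apply/Xset_coset => //; eexists; eexists; exact: gc.
have ginj i j : (i < M)%N -> (j < M)%N -> coset d (g i) = coset d (g j) -> i = j.
  move=> iM jM; have [gV gc] := gP _ iM; have [gV' gc'] := gP _ jM => e.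
  have := coset_refl d2 gV; rewrite e (coset_std d2 gV' gc') => -[_ gc2].
  by have [[]] := carries_inj d2 gc gc2.
split.
(* These cosets lie in vX but not in X, so the cocycle of [v] takes the value 1 there. *)
- apply: (l2sq_ge (F := fun i => coset d (v \o g i))) => [i iM|i j iM jM e].
    have [gV gc] := gP _ iM.
    split; first by exists (v \o g i) => //; exact: Vd_comp.
    rewrite (cocycE d _ vK wK) (memNset (vgX _ iM)) mem_set; last first.
      have -> : w \o (v \o g i) = g i by apply/funext => x /=; rewrite vK.
      exact: gX.
    by rewrite subr0 expr1n.
  have wv h : coset d h = [set h' | coset d (v \o h) (v \o h')].
    rewrite (translate_coset d _ vK wK); congr coset.
    by apply/funext => x /=; rewrite vK.
  by apply: ginj => //; rewrite wv e -wv.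
(* These cosets lie in X but not in wX, so the cocycle of [w] takes the value -1 there. *)
- apply: (l2sq_ge (F := fun i => coset d (g i))) => // i iM.
  have [gV gc] := gP _ iM; split; first by exists (g i).
  rewrite (cocycE d _ wK vK) (memNset (vgX _ iM)) mem_set; last exact: gX.
  by rewrite sub0r sqrrN expr1n.
Qed.

Lemma finite_std_cosets N :
  finite_set [set S | exists k a,
    [/\ (k < N)%N, (a < d ^ k)%N & S = @std_coset R d k a]].
Proof.
have fin : finite_set [set: 'I_N * 'I_(d ^ N)] by exact: finite_finset.
pose F (p : 'I_N * 'I_(d ^ N)) := @std_coset R d p.1 p.2.
apply: (sub_finite_set _ (finite_image F fin)).
move=> S [k [a [kN ak ->]]].
have aN : (a < d ^ N)%N by rewrite (leq_trans ak) // leq_exp2l // ltnW.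
by exists (Ordinal kN, Ordinal aN).
Qed.

(** On the support, either [g] lies over an interval that [w] does not carry, or [w \o g] lies over
    one that [v] does not carry. Such intervals have bounded level; in the second case the coset is
    a translate by [v]. *)
Lemma cocyc_finite_support v : Vd d v ->
  finite_set [set S | cosets d S /\ cocyc d v S != 0].
Proof.
move=> vV; have [w tv] := Vd_tame d2 vV; have [vK wK _ _] := tv.
have [N vN] := tame_carries d2 tv.
have [N' wN] := tame_carries d2 (tame_inv d2 tv).
have wV := tame_Vd d2 (tame_inv d2 tv).
have bounded u L S g : Vd d u -> Vd d g ->
    (forall M, (L <= M)%N -> forall a, (a < d ^ M)%N ->
      exists l b, carries d u M a l b) ->
    Xset d (coset d g) -> ~ Xset d (coset d (u \o g)) ->
    exists k a, [/\ (k < L)%N, (a < d ^ k)%N & coset d g = std_coset d k a].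
  move=> uV gV uL /(Xset_coset d2 gV)[k [a ga]] ugX; exists k, a.
  have ak := carries_lt ga; split=> //; last exact: coset_std.
  rewrite ltnNge; apply/negP => /uL/(_ _ ak)[l [b uab]]; apply: ugX.
  apply/Xset_coset => //; first exact: Vd_comp.
  by exists l, b; exact: carries_comp ga uab.
have fin : finite_set ([set S | exists k a,
       [/\ (k < N')%N, (a < d ^ k)%N & S = @std_coset R d k a]] `|`
     [set [set h | S (w \o h)] | S in [set S | exists k a,
       [/\ (k < N)%N, (a < d ^ k)%N & S = @std_coset R d k a]]]).
  by rewrite finite_setU; split; [|apply: finite_image]; exact: finite_std_cosets.
apply: (sub_finite_set _ fin) => S /= [[g gV ->]].
rewrite (cocycE d _ vK wK) => chi.
have [gX|gX] := pselect (Xset d (coset d g)).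
  left; apply: (bounded w) => // wgX.
  by rewrite !mem_set // subrr eqxx in chi.
have [wgX|wgX] := pselect (Xset d (coset d (w \o g))); last first.
  by rewrite !memNset // subrr eqxx in chi.
have vwg : v \o (w \o g) = g by apply/funext => x /=; rewrite wK.
right; exists (coset d (w \o g)); last by rewrite (translate_coset d _ wK vK) vwg.
by apply: (bounded v) => //; [exact: Vd_comp|rewrite vwg].
Qed.

(** If l is at least M, [w] carries the ancestor of level M of the image to some level m, hence the
    image itself to level m + (l - M). This must be M, so l = 2M - m. *)
Lemma carries_level_le v w M a l b : tame d v w ->
  (forall c, (c < d ^ M)%N -> exists l b, carries d w M c l b) ->
  (a < d ^ M)%N -> carries d v M a l b -> (l <= M + M)%N.
Proof.
move=> [vK wK _ _] wM aM vab; rewrite leqNgt; apply/negP => Ml.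
have Ml' : (M <= l)%N by lia.
have [|m [c wbc]] := wM (b %/ d ^ (l - M))%N.
  by apply: (ancestor_lt d2); rewrite subnKC // (carries_lt vab).
have {}wbc := carries_sub d2 wbc; rewrite subnKC // in wbc.
have [] := carries_inj d2 wbc (carries_inv d2 aM vK vab); lia.
Qed.

(* An element carrying every interval of level [M] to one of level at most [2M]
   is recovered from the table of levels and positions of the images. *)
Definition decode M
    (t : {ffun 'I_(d ^ M).-1.+1 -> 'I_(M + M).+1 * 'I_(d ^ (M + M))}) x : R :=
  if `[< unitI x >] then
    let c := Num.truncn (x * d%:R ^+ M) in
    (x * d%:R ^+ M - c%:R + (t (inord c)).2%:R) / d%:R ^+ (t (inord c)).1
  else x.

Lemma finite_carries M : finite_set [set v | exists w, [/\ tame d v w,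
  forall c, (c < d ^ M)%N -> exists l b, carries d v M c l b &
  forall c, (c < d ^ M)%N -> exists l b, carries d w M c l b]].
Proof.
have fin : finite_set [set: {ffun 'I_(d ^ M).-1.+1 ->
    'I_(M + M).+1 * 'I_(d ^ (M + M))}].
  exact: finite_finset.
apply: (sub_finite_set _ (finite_image (@decode M) fin)) => v [w [tv vM wM]].
(* The successor form of d^M is what [inord] in [decode] requires. *)
have dM : (d ^ M).-1.+1 = (d ^ M)%N by rewrite prednK // dn_gt0.
have /choice[t tP] : forall c : 'I_(d ^ M).-1.+1,
    exists p : 'I_(M + M).+1 * 'I_(d ^ (M + M)), carries d v M c p.1 p.2.
  move=> c; have cM : (c < d ^ M)%N by rewrite -{2}dM.
  have [l [b vb]] := vM _ cM.
  have lM : (l < (M + M).+1)%N by rewrite ltnS (carries_level_le tv wM cM vb).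
  have bM : (b < d ^ (M + M))%N.
    by rewrite (leq_trans (carries_lt vb)) // leq_exp2l // ltnW.
  by exists (Ordinal lM, Ordinal bM).
exists (finfun t) => //; apply/funext => x; rewrite /decode.
have [xI|xI] := pselect (unitI x); last by rewrite asboolF //; have [_ _ ->] := tv.
rewrite asboolT //; have [cM xc] := unitI_itv d2 M xI.
set c := Num.truncn _ in cM xc *; rewrite ffunE.
have ci : (inord c : 'I_(d ^ M).-1.+1) = c :> nat by rewrite inordK // dM.
have := (tP (inord c)).2; rewrite ci => /(_ _ xc) <-.
by rewrite mulfK // (dX_neq0 R d2).
Qed.

Lemma cocyc_proper (r : R) :
  finite_set [set v | Vd d v /\ (l2sq d (cocyc d v) <= (r ^+ 2)%:E)%E].
Proof.
have [M rM] : exists M, r ^+ 2 < M%:R.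
  by exists (Num.truncn (r ^+ 2)).+1; exact: truncnS_gt.
apply: (sub_finite_set _ (finite_carries M)) => v [vV lv].
have [w tv] := Vd_tame d2 vV; exists w.
have small : ~ (M%:R%:E <= l2sq d (cocyc d v))%E.
  by move=> /le_trans/(_ lv); rewrite lee_fin leNgt rM.
split=> // c cM; apply: contrapT => nc; apply: small.
  by have [] := not_carries_l2sq tv cM nc.
by have [] := not_carries_l2sq (tame_inv d2 tv) cM nc.
Qed.

End Cocycle.

Theorem theorem5p5 (R : realType) (d : nat) (hd : (2 <= d)%N) :
  (* (i) c(v) is in l^2 of the coset space *)
  (forall v : R -> R, Vd d v -> (l2sq d (cocyc d v) < +oo)%E) /\
  (* (ii) c is a 1-cocycle for the quasi-regular representation ... *)
  (forall v1 v2 : R -> R, Vd d v1 -> Vd d v2 ->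
     forall S, cosets d S ->
       cocyc d (v1 \o v2) S = lam v1 (cocyc d v2) S + cocyc d v1 S) /\
  (* ... which is proper *)
  (forall r : R, 0 <= r ->
     finite_set [set v | Vd d v /\ (l2sq d (cocyc d v) <= (r ^+ 2)%:E)%E]) /\
  (* in particular its restrictions to T_d and F_d are proper cocycles *)
  (forall r : R, 0 <= r ->
     finite_set [set v | Td d v /\ (l2sq d (cocyc d v) <= (r ^+ 2)%:E)%E]) /\
  (forall r : R, 0 <= r ->
     finite_set [set v | Fd d v /\ (l2sq d (cocyc d v) <= (r ^+ 2)%:E)%E]).
Proof.
split; first by move=> v vV; exact/l2sq_finite/cocyc_finite_support.
split.
  (* Translating by [v1 \o v2] is translating by [v2] and then by [v1], so the coboundary
     telescopes. *)
  move=> v1 v2 _ _ S _; rewrite /cocyc /lam /=.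
  by rewrite addrA subrK.
split; first by move=> r _; exact: cocyc_proper.
split=> r _; apply: (sub_finite_set _ (cocyc_proper hd r)).
  by move=> v [[vV _] lv].
by move=> v [[vV _] lv].
Qed.
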